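(* Let $G$ be a $\partial$-graph which is recoverable by scaffolds. Then $G$ is recoverable over every field $\mathbb{F}$; that is, for every field $\mathbb{F}$, the map $w \mapsto \Lambda(G,w)$ is injective on the set of weight functions $w: E \to \mathbb{F}\setminus\{0\}$ with $w(e)=w(\overline{e})$.
   Context: A graph is a countable, locally finite, undirected multigraph (self-loops allowed) with vertex set $V$ and set $E$ of oriented edges; each $e\in E$ has a starting vertex $e_-$, an ending vertex $e_+$, and a reverse $\overline{e}\in E$ with $\overline{\overline{e}}=e$, $(\overline{e})_\pm=e_\mp$. The degree of a vertex $p$ is $\#\{e\in E: e_+=p\}$. A $\partial$-graph is a graph with $V$ partitioned into interior vertices $V^\circ$ and boundary vertices $\partial V$. For a field $\mathbb{F}$, an $\mathbb{F}$-network $(G,w)$ is a $\partial$-graph with $w:E\to\mathbb{F}\setminus\{0\}$, $w(e)=w(\overline e)$. For $u:V\to\mathbb{F}$, $\Delta u(p)=\sum_{e:e_+=p}w(e)(u(e_+)-u(e_-))$; $u$ is harmonic if $\Delta u(p)=0$ for all $p\in V^\circ$. The boundary behavior is $\Lambda(G,w)=\{(u|_{\partial V},\Delta u|_{\partial V}): u \text{ harmonic}\}\subset \mathbb{F}^{\partial V}\times\mathbb{F}^{\partial V}$. A harmonic subgraph $G'$ of $G$ has $V'\subset V$, $E'\subset E$ closed under reversal with endpoints in $V'$, $V'^\circ\subset V^\circ$, and every $e$ with $e_+\in V'^\circ$ lies in $E'$. A boundary edge is an edge with both endpoints in $\partial V$; a boundary spike is an edge with one endpoint $p\in\partial V$ of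 degree $1$ and the other $q\in V^\circ$; an isolated boundary vertex is a boundary vertex of degree $0$. A layer-stripping operation is one of: deleting any set (possibly empty or infinite) of boundary edges (with their reverses); deleting any set of isolated boundary vertices; contracting any set of boundary spikes no two of which share an endpoint, where contracting a spike $e$ from $p\in\partial V$ to $q\in V^\circ$ deletes $p,e,\overline e$ and makes $q$ a boundary vertex (so the result is a harmonic subgraph). A layerable filtration is a sequence $G=G_0\supset G_1\supset\cdots$ indexed by $\mathbb{N}$ or $\{0,\dots,n\}$ with $G_{j+1}$ obtained from $G_j$ by a layer-stripping operation and $\bigcap_j G_j=\varnothing$. Paths: a path is a sequence $(e_j)$ of oriented edges indexed by $\{0,\dots,n\}$ or $\mathbb{N}$ with $(e_j)_+=(e_{j+1})_-$; a path from a vertex $p$ starts at $p$, a path from an edge $e$ has first term $e$; the empty path is a path from $p$ to $p$. For $S\subset E$, a path is increasing (w.r.t. $S$) if it contains no edge of $\overline S=\{\overline e:e\in S\}$ and no two consecutive edges outside $S$; it is decreasing if it is increasing w.r.t. $\overline S$. Write $S_\pm=\{e_\pm:e\in S\}$. A scaffold is $S\subset E$ with $S\cap\overline S=\varnothing$ such that (1) $e\mapsto e_+$ and $e\mapsto e_-$ are injective on $S$; (2) there is no decreasing path indexed by $\mathbb{N}$; (3) if there is an increasing path from $p\in V^\circ$ to $q\in V^\circ$ then $p\in S_+$ or $q\in S_-$. The End of $S$ consists of vertices/edges from which there is a decreasing path to an interior vertex not in $S_+$; the Beginning consists of vertices/edges from which there is an increasing path to an interior vertex not in $S_-$; the Middle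 $\mathrm{Mid}\,S$ is everything else. $G$ is recoverable by scaffolds if it has a layerable filtration $(G_j)$ such that each boundary edge $e$ deleted from $G_j$ admits a scaffold $S$ of $G_j$ with $e\in S\cup\overline S$ and $e\in\mathrm{Mid}\,S$, and each boundary spike $e$ contracted in $G_j$ admits a scaffold $S$ of $G_j$ with $e\notin S\cup\overline S$ and $e\in\mathrm{Mid}\,S$.
   Formalization: ''e ∈ Mid S'' for a deleted or contracted edge is taken to mean that both e and its reverse lie in Mid S for the same scaffold; with one orientation only, the claim fails for the 3-star plus an edge joining two leaves. *)

(* Defs.v *)
From mathcomp Require Import all_boot all_algebra finmap.
From mathcomp Require Import boolp classical_sets functions cardinality fsbigop.

Set Implicit Arguments.
Unset Strict Implicit.
Unset Printing Implicit Defensive.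

Import GRing.Theory.
Local Open Scope classical_set_scope.
Local Open Scope ring_scope.

(* A ∂-graph.  [estart e], [eend e] and [erev e] are e_-, e_+ and the reverse
   of the oriented edge e; the boundary is the complement of [interior]. *)
Record dgraph := DGraph {
  vertex : countType;
  edge : countType;
  estart : edge -> vertex;
  eend : edge -> vertex;
  erev : edge -> edge;
  erevK : forall e, erev (erev e) = e;
  estart_rev : forall e, estart (erev e) = eend e;
  eend_rev : forall e, eend (erev e) = estart e;
  locally_finite : forall p, finite_set [set e | eend e = p];
  interior : set vertex
}.

Arguments interior : clear implicits.

Definition boundary (G : dgraph) : set (vertex G) := ~` interior G.
Arguments boundary : clear implicits.

Section Networks.
Variables (F : fieldType) (G : dgraph).

Definition weights : set (edge G -> F) :=
  [set w | forall e, w e != 0 /\ w (erev e) = w e].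

(* The range of summation is finite by [locally_finite]. *)
Definition laplacian (w : edge G -> F) (u : vertex G -> F) (p : vertex G) : F :=
  \sum_(e \in [set e | eend e = p]) w e * (u (eend e) - u (estart e)).

Definition harmonic (w : edge G -> F) : set (vertex G -> F) :=
  [set u | forall p, interior G p -> laplacian w u p = 0].

Definition on_boundary (f : vertex G -> F) : boundary G -> F :=
  fun p => f (val p).

Definition boundary_behavior (w : edge G -> F) :
    set ((boundary G -> F) * (boundary G -> F)) :=
  [set (on_boundary u, on_boundary (laplacian w u)) | u in harmonic w].

Definition recoverable : Prop := set_inj weights boundary_behavior.

End Networks.

(* The members of a filtration of G are ∂-graphs carried by sets of vertices
   and edges of G, with the incidence maps of G.  A vertex of such a subgraph
   may be a boundary vertex of it while being interior in G. *)
Record subdgraph (G : dgraph) := SubDGraph {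
  sub_vertex : set (vertex G);
  sub_edge : set (edge G);
  sub_interior : set (vertex G)
}.

Definition whole (G : dgraph) : subdgraph G := SubDGraph setT setT (interior G).

Section Subgraphs.
Variable G : dgraph.
Implicit Types (H K : subdgraph G) (p q : vertex G) (e f : edge G).

Definition reverse (S : set (edge G)) : set (edge G) := @erev G @` S.

Definition sub_boundary H : set (vertex G) := sub_vertex H `\` sub_interior H.

Definition degree H p : nat :=
  #|` fset_set [set e | sub_edge H e /\ eend e = p]|.

Definition boundary_edge H : set (edge G) :=
  [set e | [/\ sub_edge H e, sub_boundary H (estart e)
                           & sub_boundary H (eend e)]].

(* Oriented from the boundary vertex of degree 1 to the interior vertex. *)
Definition boundary_spike H : set (edge G) :=
  [set e | [/\ sub_edge H e, sub_boundary H (estart e),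
               degree H (estart e) = 1%N & sub_interior H (eend e)]].

Definition isolated_boundary_vertex H : set (vertex G) :=
  [set p | sub_boundary H p /\ degree H p = 0%N].

Definition delete_edges H (A : set (edge G)) : subdgraph G :=
  SubDGraph (sub_vertex H) (sub_edge H `\` (A `|` reverse A)) (sub_interior H).

Definition delete_vertices H (A : set (vertex G)) : subdgraph G :=
  SubDGraph (sub_vertex H `\` A) (sub_edge H) (sub_interior H).

Definition contract_spikes H (A : set (edge G)) : subdgraph G :=
  SubDGraph (sub_vertex H `\` @estart G @` A)
            (sub_edge H `\` (A `|` reverse A))
            (sub_interior H `\` @eend G @` A).

Definition endpoints e : set (vertex G) := [set estart e; eend e].

Variant layer_stripping H : subdgraph G -> Prop :=
| StripEdges A : A `<=` boundary_edge H -> layer_stripping H (delete_edges H A)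
| StripVertices A : A `<=` isolated_boundary_vertex H ->
    layer_stripping H (delete_vertices H A)
| StripSpikes A : A `<=` boundary_spike H -> trivIset A endpoints ->
    layer_stripping H (contract_spikes H A).

(* A filtration is indexed by {0, ..., n} if N = Some n and by all naturals if
   N = None; the values Gs j at other indices j are irrelevant. *)
Definition indices (N : option nat) : set nat :=
  [set j | if N is Some n then (j <= n)%N else true].

Definition layerable_filtration (N : option nat) (Gs : nat -> subdgraph G) :
    Prop :=
  [/\ Gs 0%N = whole G,
      forall j, indices N j.+1 -> layer_stripping (Gs j) (Gs j.+1),
      \bigcap_(j in indices N) sub_vertex (Gs j) = set0
    & \bigcap_(j in indices N) sub_edge (Gs j) = set0].

(* [walk p s q]: the finite sequence s of edges is a path from p to q. *)
Fixpoint walk p (s : seq (edge G)) q : Prop :=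
  if s is e :: s' then estart e = p /\ walk (eend e) s' q else p = q.

(* The condition for a finite path s to be increasing with respect to S. *)
Definition increasing (S : set (edge G)) (s : seq (edge G)) : Prop :=
  (forall e, e \in s -> ~ reverse S e) /\
  (forall s1 e f s2, s = s1 ++ [:: e, f & s2] -> S e \/ S f).

Definition increasing_path H S p (s : seq (edge G)) q : Prop :=
  [/\ sub_vertex H p, forall e, e \in s -> sub_edge H e, walk p s q
    & increasing S s].

Definition infinite_increasing_path H S (g : nat -> edge G) : Prop :=
  [/\ forall j, sub_edge H (g j), forall j, eend (g j) = estart (g j.+1),
      forall j, ~ reverse S (g j) & forall j, S (g j) \/ S (g j.+1)].

(* Increasing path from a vertex or an edge x to the vertex q. *)
Definition increasing_from_to H S (x : vertex G + edge G) q : Prop :=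
  match x with
  | inl p => exists s, increasing_path H S p s q
  | inr e => exists s, increasing_path H S (estart e) (e :: s) q
  end.

Definition decreasing_from_to H S x q : Prop :=
  increasing_from_to H (reverse S) x q.

Definition scaffold H (S : set (edge G)) : Prop :=
  [/\ S `<=` sub_edge H /\ S `&` reverse S = set0,
      set_inj S (@eend G) /\ set_inj S (@estart G),
      ~ (exists g, infinite_increasing_path H (reverse S) g)
    & forall p q, sub_interior H p -> sub_interior H q ->
        increasing_from_to H S (inl p) q ->
        (@eend G @` S) p \/ (@estart G @` S) q].

Definition scaffold_end H S : set (vertex G + edge G) :=
  [set x | exists q, [/\ sub_interior H q, ~ (@eend G @` S) q
                       & decreasing_from_to H S x q]].

Definition scaffold_beginning H S : set (vertex G + edge G) :=
  [set x | exists q, [/\ sub_interior H q, ~ (@estart G @` S) q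
                       & increasing_from_to H S x q]].

Definition scaffold_middle H S : set (vertex G + edge G) :=
  ([set inl p | p in sub_vertex H] `|` [set inr e | e in sub_edge H])
    `\` (scaffold_beginning H S `|` scaffold_end H S).

(* An edge that is deleted or contracted is unoriented: it lies in the Middle
   when both of its orientations do.  With a condition on one orientation only,
   the star with three leaves plus an edge between two of the leaves (leaves
   boundary, center interior) would be recoverable by scaffolds, although its
   weights are not determined by its boundary behavior. *)
Definition edge_in_middle H S e : Prop :=
  scaffold_middle H S (inr e) /\ scaffold_middle H S (inr (erev e)).

End Subgraphs.

Definition recoverable_by_scaffolds (G : dgraph) : Prop :=
  exists (N : option nat) (Gs : nat -> subdgraph G),
    layerable_filtration N Gs /\
    forall j e, indices N j.+1 ->
      sub_edge (Gs j) e -> ~ sub_edge (Gs j.+1) e ->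
      (boundary_edge (Gs j) e ->
         exists S, [/\ scaffold (Gs j) S, (S `|` reverse S) e
                     & edge_in_middle (Gs j) S e]) /\
      (boundary_spike (Gs j) e ->
         exists S, [/\ scaffold (Gs j) S, ~ (S `|` reverse S) e
                     & edge_in_middle (Gs j) S e]).

(* Main.v *)
Require Import Defs.
From mathcomp Require Import all_boot all_algebra finmap ring.
From mathcomp Require Import boolp classical_sets functions cardinality fsbigop.
From Stdlib Require Import Relation_Operators Operators_Properties Wellfounded.

Set Implicit Arguments.
Unset Strict Implicit.
Unset Printing Implicit Defensive.

Import GRing.Theory.
Local Open Scope classical_set_scope.
Local Open Scope ring_scope.

(** Only the inclusion of boundary behaviors is needed, and it passes from each
    subgraph of the filtration to the next once the weights of the removed edges
    are known to agree: contracting a spike changes the boundary data by a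
    substitution that involves only the weight of the spike.

    The weight of a removed edge is found as follows.  A scaffold S lets one solve
    the equation at the start of each edge of S for the value of the potential at
    its end; the recursion is well-founded as no decreasing path is infinite.
    Values therefore propagate along increasing paths.  Feed a unit potential (for
    a spike outside S) or a unit current (for a boundary edge in S) at the start of
    the edge.  As the edge is not in the Beginning, no increasing path carries the
    perturbation to an interior vertex where no equation was solved, so the
    resulting potential is harmonic.  As the edge is not in the End, the values
    on the other side of the edge depend on boundary data only, hence are the same
    for all weights; the net current at the start then gives the weight. *)

(** * Laplacians on subgraphs, and boundary behavior under layer-stripping *)

Section SubLaplacian.
Variables (F : fieldType) (G : dgraph).
Implicit Types (H K : subdgraph G) (p q : vertex G) (e f a : edge G).
Implicit Types (w : edge G -> F) (u : vertex G -> F).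

Definition edges_at p : {fset edge G} := fset_set [set e | eend e = p].

Lemma edges_atP p e : reflect (eend e = p) (e \in edges_at p).
Proof.
rewrite in_fset_set; last exact: locally_finite.
by apply: (iffP idP) => [/set_mem|/mem_set].
Qed.

(** The sum runs over a finite set independent of [H], with membership in [H] as a filter, so that
    the Laplacians of different subgraphs compare termwise. *)
Definition sub_laplacian H w u p : F :=
  \sum_(e <- edges_at p | `[< sub_edge H e >]) w e * (u p - u (estart e)).

Lemma laplacianE w u p : laplacian w u p = sub_laplacian (whole G) w u p.
Proof.
rewrite /laplacian fsbig_finite; last exact: locally_finite.
rewrite /sub_laplacian big_seq_cond [RHS]big_seq_cond; apply: eq_big => e.
  by rewrite asboolT.
by rewrite andbT => /edges_atP ->.
Qed.

Lemma eq_sub_laplacian H K w w' u u' p : u p = u' p ->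
    (forall e, eend e = p -> (sub_edge H e <-> sub_edge K e)) ->
    (forall e, eend e = p -> sub_edge H e ->
      w e = w' e /\ u (estart e) = u' (estart e)) ->
  sub_laplacian H w u p = sub_laplacian K w' u' p.
Proof.
move=> up HK eq_wu; rewrite /sub_laplacian big_seq_cond [RHS]big_seq_cond.
apply: eq_big => e.
  by case: edges_atP => //= ep; apply: asbool_equiv_eq; apply: HK.
by case/andP=> /edges_atP ep /asboolP He; have [-> ->] := eq_wu e ep He; rewrite up.
Qed.

Definition edge_diff H K : subdgraph G :=
  SubDGraph (sub_vertex H) (sub_edge H `\` sub_edge K) (sub_interior H).

Lemma sub_laplacian_split H K w u p :
    (forall e, eend e = p -> sub_edge K e -> sub_edge H e) ->
  sub_laplacian H w u p =
    sub_laplacian K w u p + sub_laplacian (edge_diff H K) w u p.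
Proof.
move=> KH; rewrite /sub_laplacian (bigID (fun e => `[< sub_edge K e >])) /=.
congr (_ + _); rewrite big_seq_cond [RHS]big_seq_cond; apply: eq_bigl => e.
  case: edges_atP => //= ep; rewrite -asbool_and; apply: asbool_equiv_eq.
  by split=> [[]//|Ke]; split=> //; exact: KH.
by case: edges_atP => //= ep; rewrite -asbool_neg -asbool_and.
Qed.

(** A single orientation is removed: if [a] is a self-loop, a distinct reverse contributes a term of
    its own at the same vertex. *)
Definition remove_edge H a : subdgraph G :=
  SubDGraph (sub_vertex H) (sub_edge H `\ a) (sub_interior H).

Lemma sub_laplacianD1 H w u a : sub_edge H a ->
  sub_laplacian H w u (eend a) = w a * (u (eend a) - u (estart a))
    + sub_laplacian (remove_edge H a) w u (eend a).
Proof.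
move=> Ha; rewrite {1}/sub_laplacian big_mkcond /= (bigD1_seq a) ?fset_uniq //=;
  last exact/edges_atP.
rewrite asboolT //; congr (_ + _); rewrite -big_mkcondr; apply: eq_bigl => e.
apply/andP/asboolP => /= [[/eqP ea /asboolP He]|[He /eqP ea]]; split => //.
exact/asboolP.
Qed.

Lemma sub_laplacian_eq0 H w u p : u p = 0 ->
    (forall e, eend e = p -> sub_edge H e -> u (estart e) = 0) ->
  sub_laplacian H w u p = 0.
Proof.
move=> up ue; rewrite /sub_laplacian big_seq_cond big1 // => e.
by case/andP=> /edges_atP ep /asboolP He; rewrite up ue // subr0 mulr0.
Qed.

Definition edge_sym H := forall e, sub_edge H e -> sub_edge H (erev e).

Definition edge_incident H :=
  forall e, sub_edge H e -> sub_vertex H (eend e).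

Lemma degree1_inj H e f : degree H (eend e) = 1%N -> eend f = eend e ->
  sub_edge H e -> sub_edge H f -> f = e.
Proof.
move=> /eqP/cardfs1P[x defx] fe He Hf.
have fin : finite_set [set g | sub_edge H g /\ eend g = eend e].
  by apply: sub_finite_set (locally_finite (eend e)) => g [].
have at1 g : sub_edge H g -> eend g = eend e -> g = x.
  move=> Hg ge; apply/fset1P; rewrite -defx in_fset_set //; exact/mem_set.
by rewrite (at1 f) // (at1 e).
Qed.

(** The degree counts incoming edges, so it is applied to the reverses of [f] and [a]. *)
Lemma spike_unique H a f : edge_sym H -> boundary_spike H a ->
  sub_edge H f -> estart f = estart a -> f = a.
Proof.
move=> symH [Ha _ deg1 _] Hf fa; apply: (can_inj (@erevK G)).
apply: (degree1_inj (H := H)); rewrite ?eend_rev //; exact: symH.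
Qed.

Lemma sub_laplacian_spike H w u a : edge_sym H -> boundary_spike H a ->
  sub_laplacian H w u (estart a) = w (erev a) * (u (estart a) - u (eend a)).
Proof.
move=> symH spa; have [Ha _ _ _] := spa.
have := sub_laplacianD1 w u (symH _ Ha); rewrite eend_rev estart_rev => ->.
rewrite [X in _ + X]big_seq_cond big1 ?addr0 // => e.
case/andP=> /edges_atP ep /asboolP[/= He []].
by rewrite -[e in LHS]erevK (spike_unique symH spa (symH _ He)) ?estart_rev.
Qed.

Definition sub_harmonic H w : set (vertex G -> F) :=
  [set u | forall p, sub_interior H p -> sub_laplacian H w u p = 0].

(* Inclusion of the boundary behavior of (H, w) in that of (H, w'). *)
Definition behavior_incl H w w' := forall u, sub_harmonic H w u ->
  exists2 u', sub_harmonic H w' u' &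
    forall p, sub_boundary H p ->
      u' p = u p /\ sub_laplacian H w' u' p = sub_laplacian H w u p.

Lemma behavior_incl_whole w w' : boundary_behavior w = boundary_behavior w' ->
  behavior_incl (whole G) w w'.
Proof.
move=> eqL u harm_u.
have : boundary_behavior w (on_boundary u, on_boundary (laplacian w u)).
  by exists u => // p ip; rewrite laplacianE harm_u.
rewrite eqL => -[u' harm_u' [eq_u eq_lap]]; exists u' => [p ip|p [_ bp]].
  by rewrite -laplacianE harm_u'.
have bp' : p \in boundary G by exact/mem_set.
have := congr1 (@^~ (SigSub bp')) eq_u; have := congr1 (@^~ (SigSub bp')) eq_lap.
by rewrite /on_boundary /= !laplacianE.
Qed.

Lemma edge_sym_setD H A e : edge_sym H -> (sub_edge H `\` (A `|` reverse A)) e ->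
  (sub_edge H `\` (A `|` reverse A)) (erev e).
Proof.
move=> symH [He nAe]; split; first exact: symH.
case=> [Ae|[f Af /(can_inj (@erevK G)) fe]]; apply: nAe.
  by right; exists (erev e); rewrite ?erevK.
by left; rewrite -fe.
Qed.

Lemma edge_sym_strip H K : layer_stripping H K -> edge_sym H -> edge_sym K.
Proof. by case=> // A *; move=> e; exact: edge_sym_setD. Qed.

Lemma edge_incident_strip H K : layer_stripping H K -> edge_sym H ->
  edge_incident H -> edge_incident K.
Proof.
case=> [A _|A isoA|A spA _] symH incH e /=; first by case=> /incH.
  move=> He; split=> [|/isoA[_]]; first exact: incH.
  rewrite /degree => /cardfs0_eq dege.
  have : e \in fset_set [set f | sub_edge H f /\ eend f = eend e].
    rewrite in_fset_set; first exact/mem_set.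
    by apply: sub_finite_set (locally_finite (eend e)) => g [].
  by rewrite dege.
case=> He nAe; split=> [|[a Aa ae]]; first exact: incH.
apply: nAe; right; exists a => //.
by rewrite -(spike_unique symH (spA _ Aa) (symH _ He)) ?erevK ?estart_rev.
Qed.

(** Deleted edges touch boundary vertices only. The interior equations are unchanged, and a boundary
    Laplacian loses a sum that depends on boundary values and on weights already known to agree. *)
Lemma behavior_incl_delete_edges H A w w' :
    A `<=` boundary_edge H ->
    (forall e, sub_edge H e -> ~ sub_edge (delete_edges H A) e -> w e = w' e) ->
  behavior_incl H w w' -> behavior_incl (delete_edges H A) w w'.
Proof.
set H' := delete_edges H A => bA eqw incl.
have bAr e : (A `|` reverse A) e -> sub_boundary H (estart e) /\ sub_boundary H (eend e).
  case=> [/bA[]//|[f /bA[_ bf1 bf2] <-]]; by rewrite estart_rev eend_rev.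
have int_lap w0 u p : sub_interior H p -> sub_laplacian H' w0 u p = sub_laplacian H w0 u p.
  move=> ip; apply: eq_sub_laplacian => // e ep; split=> [[]//|He]; split=> //.
  by move/bAr => [_ [_]]; rewrite ep.
have sub_lap w0 u p : sub_laplacian H w0 u p =
    sub_laplacian H' w0 u p + sub_laplacian (edge_diff H H') w0 u p.
  by apply: sub_laplacian_split => e _ [].
move=> u harm_u; have [p ip|u' harm_u' bu'] := incl u.
  by rewrite -int_lap //; exact: harm_u.
exists u' => [p ip|p bp]; first by rewrite int_lap //; exact: harm_u'.
have [-> lap_p] := bu' p bp; split=> //; move: lap_p; rewrite !sub_lap.
rewrite (_ : sub_laplacian (edge_diff H H') w' u' p =
             sub_laplacian (edge_diff H H') w u p); first by move/addIr.
apply: eq_sub_laplacian => [||e ep [He H'e]] //; first by case: (bu' p bp).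
split; first by rewrite eqw.
have /bAr[bs _] : (A `|` reverse A) e by apply: contrapT => nA; apply: H'e; split.
by case: (bu' _ bs).
Qed.

Lemma behavior_incl_delete_vertices H A w w' :
  behavior_incl H w w' -> behavior_incl (delete_vertices H A) w w'.
Proof.
move=> incl u /incl[u' harm_u' bu']; exists u' => // p [[Hp _] np].
exact: bu'.
Qed.

Lemma behavior_incl_contract_spikes H A w w' : edge_sym H ->
    weights w -> weights w' ->
    A `<=` boundary_spike H -> trivIset A (@endpoints G) ->
    (forall e, sub_edge H e -> ~ sub_edge (contract_spikes H A) e -> w e = w' e) ->
  behavior_incl H w w' -> behavior_incl (contract_spikes H A) w w'.
Proof.
set H' := contract_spikes H A => symH Ww Ww' spA trivA eqw incl.
have inj_start a b : A a -> A b -> estart a = estart b -> a = b.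
  by move=> Aa Ab ab; apply: trivA => //; exists (estart a); split; left.
have inj_end a b : A a -> A b -> eend a = eend b -> a = b.
  by move=> Aa Ab ab; apply: trivA => //; exists (eend a); split; right.
have H'_start f a : sub_edge H' f -> A a -> estart f <> estart a.
  move=> [Hf nAf] Aa fa; apply: nAf; left.
  by rewrite (spike_unique symH (spA _ Aa) Hf fa).
have H'_end f p : eend f = p -> (sub_interior H `\` @eend G @` A) p \/
    (sub_boundary H `\` @estart G @` A) p -> (sub_edge H' f <-> sub_edge H f).
  move=> fp Hp; split=> [[]//|Hf]; split=> // -[Af|[g Ag gf]].
    case: Hp => [[_ []]|[[_ np] _]]; first by exists f.
    by apply: np; rewrite -fp; case: (spA _ Af).
  have pg : p = estart g by rewrite -fp -gf eend_rev.
  case: Hp => [[ip _]|[_ []]]; last by exists g.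
  by have [_ [_ []]] := spA _ Ag; rewrite -pg.
have lap_end w0 v a : A a -> sub_laplacian H w0 v (eend a) =
    w0 a * (v (eend a) - v (estart a)) + sub_laplacian H' w0 v (eend a).
  move=> Aa; have [Ha _ _ ia] := spA _ Aa; rewrite sub_laplacianD1 //; congr (_ + _).
  apply: eq_sub_laplacian => // f fa; split=> [[Hf fna]|[Hf nAf]]; split=> //.
    case=> [Af|[g Ag gf]]; first by apply: fna; exact: inj_end.
    by have [_ [_ []]] := spA _ Ag; rewrite -eend_rev gf fa.
  by move=> fa'; apply: nAf; left; rewrite fa'.
move=> u harm_u.
pose spike_at p := [set a | A a /\ estart a = p].
(* A potential on the contracted graph extends to [H]: the value at the start of a spike is chosen
   so that the Laplacian vanishes at its end, which is interior in [H]. *)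
pose v p := if pselect (exists a, spike_at p a) is left ex then
  let a := projT1 (cid ex) in
  u (eend a) + sub_laplacian H' w u (eend a) / w a else u p.
have v_start a : A a ->
    v (estart a) = u (eend a) + sub_laplacian H' w u (eend a) / w a.
  move=> Aa; rewrite /v; case: pselect => [ex|[]]; last by exists a.
  by case: cid => b [Ab ba] /=; rewrite (inj_start b a).
have v_other p : (forall a, A a -> p <> estart a) -> v p = u p.
  by move=> np; rewrite /v; case: pselect => // -[a [Aa pa]]; case: (np a Aa).
have int_other p : sub_interior H p -> v p = u p.
  by move=> ip; apply: v_other => a /spA[_ [_ nia] _ _] pa; rewrite pa in ip.
have lap_v p : v p = u p -> sub_laplacian H' w v p = sub_laplacian H' w u p.
  move=> vp; apply: eq_sub_laplacian => // f _ H'f; split=> //.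
  by apply: v_other => a; exact: H'_start.
have harm_v : sub_harmonic H w v.
  move=> p ip; have [[a Aa ap]|npA] := pselect ((@eend G @` A) p).
    rewrite -{p}ap in ip *; rewrite lap_end // v_start // lap_v ?int_other //.
    have [wa _] := Ww a; rewrite opprD addrA subrr sub0r mulrN mulrCA divff //.
    by rewrite mulr1 addNr.
  rewrite -(@eq_sub_laplacian H' H w w v v p) //; last first.
    by move=> e ep; apply: (H'_end _ _ ep); left.
  by rewrite lap_v ?int_other // harm_u.
have [u' harm_u' bu'] := incl v harm_v.
(* The Laplacian at the start of a spike is its weight times the potential drop; as this weight is
   common to both networks and nonzero, the boundary data fix the value at the end. *)
have eq_end a : A a -> v (eend a) = u' (eend a) /\ u' (estart a) = v (estart a).
  move=> Aa; have spa := spA _ Aa; have [Ha ba _ _] := spa.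
  have [-> lap_a] := bu' _ ba; split=> //; move: lap_a.
  have [wa0 wra] := Ww a; have [_ wra'] := Ww' a.
  rewrite !sub_laplacian_spike // wra wra' -eqw //; last by case=> _ []; left.
  have [-> _] := bu' _ ba.
  by move/(mulfI wa0)/addrI/oppr_inj.
exists u' => [p [ip npA]|p [[Hp npA] bp]].
  rewrite (@eq_sub_laplacian H' H w' w' u' u' p) //; first exact: harm_u'.
  by move=> e ep; apply: (H'_end _ _ ep); left.
have [ip|nip] := pselect (sub_interior H p).
  have [a Aa ap] : (@eend G @` A) p by apply: contrapT => np; apply: bp.
  rewrite -{p}ap in ip npA bp Hp *; have [Ha _ _ _] := spA _ Aa.
  have [eq_e eq_s] := eq_end a Aa.
  rewrite -lap_v ?int_other // -eq_e int_other //; split=> //.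
  (* Both potentials are harmonic in [H] here, so each Laplacian in [H'] is the opposite of the term
     of the spike, and these terms agree. *)
  have /eqP := harm_v _ ip; have /eqP := harm_u' _ ip.
  rewrite !lap_end // ![_ * _ + _]addrC !addr_eq0 => /eqP -> /eqP ->.
  by rewrite -eq_e eq_s -eqw //; case=> _ []; left.
have np a : A a -> p <> estart a by move=> Aa pa; apply: npA; exists a.
have bHp : sub_boundary H p by split.
have [eq_p lap_p] := bu' _ bHp; rewrite eq_p v_other //; split=> //.
have H'p e : eend e = p -> (sub_edge H' e <-> sub_edge H e).
  by move=> ep; apply: (H'_end _ _ ep); right.
have lap_H' w0 x : sub_laplacian H' w0 x p = sub_laplacian H w0 x p.
  exact: eq_sub_laplacian.
by rewrite -lap_v ?v_other // !lap_H'.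
Qed.

End SubLaplacian.

(** * Well-founded relations and recursion *)

Section WellFounded.

Lemma acyclic T (R : T -> T -> Prop) x y : well_founded R ->
  clos_refl_trans T R x y -> ~ R y x.
Proof.
move=> wfR xy yx; have := wf_clos_trans T R wfR x; have : clos_trans T R x x.
  by apply: clos_rt_t xy _; exact: t_step.
by move=> + acc; elim: acc => z _ IH Rzz; exact: (IH z Rzz Rzz).
Qed.

Lemma clos_rt_head T (R : T -> T -> Prop) x y : clos_refl_trans T R x y ->
  x = y \/ exists2 z, R x z & clos_refl_trans T R z y.
Proof.
move=> xy; case: (clos_rt_rt1n _ _ _ _ xy) => [|z t xz zt]; first by left.
by right; exists z => //; exact: clos_rt1n_rt.
Qed.

(** An inaccessible point has an inaccessible predecessor; iterating a choice of one gives a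
    chain. *)
Lemma well_founded_no_chain T (R : T -> T -> Prop) :
  ~ (exists g : nat -> T, forall n, R (g n.+1) (g n)) -> well_founded R.
Proof.
move=> noR; apply: contrapT => /existsNP[x0 nacc0]; apply: noR.
have /choice[f fP] : forall x, exists y, ~ Acc R x -> R y x /\ ~ Acc R y.
  move=> x; have [acc|nacc] := pselect (Acc R x); first by exists x.
  apply: contrapT => nex; apply: nacc; constructor=> y yx.
  by apply: contrapT => nacc; apply: nex; exists y.
exists (fun n => iter n f x0) => n /=.
have : ~ Acc R (iter n f x0) by elim: n => //= n /fP[].
by case/fP.
Qed.

(** Values at points not below [x] are masked by [d], so that [B] may be any functional on total
    functions. *)
Lemma wf_recursion T V (d : V) (R : T -> T -> Prop) (B : T -> (T -> V) -> V) :
  well_founded R ->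
  exists u, forall x, u x = B x (fun y => if `[< R y x >] then u y else d).
Proof.
move=> wfR; pose step x (rec : forall y, R y x -> V) : V :=
  B x (fun y => if pselect (R y x) is left yx then rec y yx else d).
exists (Fix wfR (fun=> V) step) => x; rewrite Fix_eq.
  rewrite /step; congr B; apply: funext => y.
  by case: pselect => yx; rewrite ?(asboolT yx) ?(asboolF yx).
move=> y f g fg; rewrite /step; congr B; apply: funext => z.
by case: pselect.
Qed.

End WellFounded.

(** * Increasing paths and their concatenation *)

Section Paths.
Variable G : dgraph.
Implicit Types (H : subdgraph G) (S : set (edge G)) (e f : edge G).
Implicit Types (s t : seq (edge G)) (p q : vertex G).

Lemma reverseE S e : reverse S e <-> S (erev e).
Proof.
by split=> [[f Sf <-]|Se]; [rewrite erevK | exists (erev e); rewrite ?erevK].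
Qed.

Lemma reverseK S : reverse (reverse S) = S.
Proof. by apply/funext => e; apply/propext; rewrite !reverseE erevK. Qed.

(** Vacuous on the empty path. Either condition, [ends_in] on the left or [starts_in] on the right,
    prevents two edges outside [S] from meeting at a junction. *)
Definition starts_in S s := forall e t, s = e :: t -> S e.
Definition ends_in S s := forall e t, s = rcons t e -> S e.

Lemma starts_in_cat S s t : starts_in S s -> starts_in S t ->
  starts_in S (s ++ t).
Proof. by case: s => //= e s Ss _ f r [<- _]; apply: Ss. Qed.

Lemma ends_in_cat S s t : ends_in S s -> ends_in S t -> ends_in S (s ++ t).
Proof.
move=> Ss; case/lastP: t => [|t e]; first by rewrite cats0.
by move=> St f r; rewrite -rcons_cat => /rcons_inj[_ <-]; apply: St.
Qed.

Lemma increasing_cons S e s : increasing S (e :: s) <->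
  [/\ ~ reverse S e, increasing S s & forall f t, s = f :: t -> S e \/ S f].
Proof.
split=> [[nrev ok]|[ne [nrev ok] oke]].
  split; first by apply: nrev; rewrite mem_head.
    split=> [f fs|s1 f g s2 def_s]; first by apply: nrev; rewrite in_cons fs orbT.
    by apply: (ok (e :: s1) f g s2); rewrite def_s.
  by move=> f t def_s; apply: (ok [::] e f t); rewrite def_s.
split=> [f|[|e1 s1] f g s2 /=]; first by rewrite in_cons => /predU1P[->|/nrev].
  by case=> <- /oke.
by case=> _ /ok.
Qed.

Lemma increasing_nil S : increasing S [::].
Proof. by split=> // -[]. Qed.

Lemma increasing_cat S s t : increasing S s -> increasing S t ->
  ends_in S s \/ starts_in S t -> increasing S (s ++ t).
Proof.
elim: s => //= e s IH /increasing_cons[ne inc_s oke] inc_t ends.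
apply/increasing_cons; split=> //.
  apply: IH => //; case: ends => [ends|]; [left|by right].
  by move=> f r def_s; apply: (ends f (e :: r)); rewrite def_s.
move=> f r; case: s oke ends {IH inc_s} => [_ ends /= def_t|g s oke _ [<- _]].
  by case: ends => [/(_ e [::] erefl)|/(_ f r def_t)]; [left|right].
exact: oke.
Qed.

Lemma walk_cat p s q t r : walk p s q -> walk q t r -> walk p (s ++ t) r.
Proof. by elim: s p => [|e s IH] p /=; [move=> -> | case=> -> /IH{}IH /IH]. Qed.

(** Taken with [reverse S] in place of [S], this describes decreasing paths. *)
Definition monotone_path H S p s q :=
  [/\ forall e, e \in s -> sub_edge H e, walk p s q & increasing S s].

Lemma monotone_path_cat H S p s q t r :
    monotone_path H S p s q -> monotone_path H S q t r ->
    ends_in S s \/ starts_in S t -> monotone_path H S p (s ++ t) r.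
Proof.
move=> [Hs ps inc_s] [Ht pt inc_t] st; split; last exact: increasing_cat.
  by move=> e; rewrite mem_cat => /orP[/Hs|/Ht].
exact: walk_cat ps pt.
Qed.

Lemma monotone_path_nil H S p : monotone_path H S p [::] p.
Proof. by split=> //; exact: increasing_nil. Qed.

Lemma monotone_path1 H S e : sub_edge H e -> ~ reverse S e ->
  monotone_path H S (estart e) [:: e] (eend e).
Proof.
move=> He ne; split=> // [f|]; first by rewrite inE => /eqP ->.
by apply/increasing_cons; split=> //; exact: increasing_nil.
Qed.

End Paths.

(** * The dependence relation of a scaffold *)

Section Scaffold.
Variables (G : dgraph) (H : subdgraph G) (S : set (edge G)).
Hypotheses (symH : edge_sym H) (scS : scaffold H S).
Implicit Types (e f s : edge G) (p q v x y : vertex G).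

Let SH e : S e -> sub_edge H e. Proof. by case: scS => -[SH _ _ _ _]; exact: SH. Qed.

Let S_rev e : S e -> ~ reverse S e.
Proof.
by case: scS => -[_ S0] _ _ _ Se Re; have : (S `&` reverse S) e by []; rewrite S0.
Qed.

Let eend_inj e f : S e -> S f -> eend e = eend f -> e = f.
Proof. by case: scS => _ [inj _] _ _ Se Sf; apply: inj; exact/mem_set. Qed.

Let estart_inj e f : S e -> S f -> estart e = estart f -> e = f.
Proof. by case: scS => _ [_ inj] _ _ Se Sf; apply: inj; exact/mem_set. Qed.

(* The vertices on which the value at v depends when the equation at the start
   of an edge of S is solved for the value at its end. *)
Definition below y v := exists s, [/\ S s, eend s = v &
  y = estart s \/
  exists f, [/\ sub_edge H f, ~ S f, estart f = estart s & eend f = y]].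

Definition belows := clos_refl_trans _ below.

Lemma below_neighbor s f : S s -> sub_edge H f -> eend f = estart s ->
  f <> erev s -> below (estart f) (eend s).
Proof.
move=> Ss Hf fs nf; exists s; split=> //; right; exists (erev f).
split; rewrite ?estart_rev ?eend_rev //; first exact: symH.
move=> Sf; apply: nf; rewrite -(estart_inj Sf Ss) ?erevK //.
by rewrite estart_rev.
Qed.

Lemma belows_vertex y v : edge_incident H -> belows y v ->
  sub_vertex H v -> sub_vertex H y.
Proof.
move=> incH; elim=> // [y' v' [s [Ss _ yP]] _|? ? ? _ IH1 _ IH2 /IH2/IH1//].
case: yP => [->|[f [Hf _ _ <-]]]; last exact: incH.
by rewrite -eend_rev; apply: incH; apply: symH; exact: SH.
Qed.

(** A descent from [eend s] goes back along [s] and then possibly across an edge outside [S], so an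
    infinite descent would trace an infinite decreasing path. *)
Lemma below_wf : well_founded below.
Proof.
(* [next f e] says that [f] may follow [e] in a decreasing path. *)
pose next f e := [/\ sub_edge H e, ~ S e, eend e = estart f & reverse S e \/ reverse S f]
  /\ sub_edge H f /\ ~ S f.
have wf_next : well_founded next.
  apply: well_founded_no_chain => -[g gP]; case: scS => _ _ noinf _; apply: noinf.
  by exists g; split=> j; have [[Hg nSg ? ?] _] := gP j; rewrite ?reverseK.
have rev_notS s : S s -> ~ S (erev s) by move=> Ss /reverseE; exact: S_rev.
(* The vertex [eend s] is represented by the edge [erev s]. One step of [below] costs one or two
   edges of the path, hence the transitive closure. *)
have acc_end e : Acc (clos_trans _ next) e ->
    forall s, S s -> e = erev s -> Acc below (eend s).
  elim=> {}e _ IH s Ss es; constructor=> y ylt.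
  have [[t [St ty]]|noS] := pselect (exists t, S t /\ eend t = y); last first.
    by constructor=> z [t [St ty _]]; case: noS; exists t.
  rewrite -ty; apply: (IH (erev t)) => //; rewrite es.
  have tr : forall r, S r -> reverse S (erev r) by move=> r Sr; apply/reverseE; rewrite erevK.
  have Ht : forall r, S r -> sub_edge H (erev r) by move=> r /SH/symH.
  case: ylt => s' [Ss' /(eend_inj Ss' Ss) -> [ys|[f [Hf nSf fs fy]]]].
    apply: t_step; split; last by split; [exact: Ht|exact: rev_notS].
    by split; [exact: Ht|exact: rev_notS|rewrite eend_rev estart_rev ty|left; exact: tr].
  apply: (t_trans _ _ _ f); apply: t_step.
    split; last by split; [exact: Ht|exact: rev_notS].
    by split=> //; [rewrite estart_rev ty|right; exact: tr].
  split=> //; split; [exact: Ht|exact: rev_notS|by rewrite eend_rev|by left; exact: tr].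
move=> v; have [[s [Ss <-]]|noS] := pselect (exists s, S s /\ eend s = v).
  exact: (acc_end (erev s) (wf_clos_trans _ _ wf_next _) s Ss erefl).
by constructor=> z [t [St ty _]]; case: noS; exists t.
Qed.

(** Each step of [below] is an edge of [S], possibly preceded by an edge outside [reverse S]. Such
    segments end in [S], so they concatenate. *)
Lemma belows_ascent y v : belows y v ->
  exists2 s, monotone_path H S y s v & ends_in S s.
Proof.
elim=> {y v} [y v [s [Ss sv yP]]|y|x y z _ [s s1 s2] _ [t t1 t2]].
- have path_s := monotone_path1 (SH Ss) (S_rev Ss).
  have ends_s : ends_in S [:: s] by move=> e t; rewrite -[LHS]/(rcons [::] s) => /rcons_inj[_ <-].
  rewrite -sv; case: yP => [->|[f [Hf nSf fs fy]]]; first by exists [:: s].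
  exists [:: erev f; s]; last first.
    by move=> e t; rewrite -[LHS]/(rcons [:: erev f] s) => /rcons_inj[_ <-].
  apply: (@monotone_path_cat _ _ _ _ [:: erev f]) _ path_s _; last first.
    by right=> e ? [<-].
  rewrite -fs -fy -(eend_rev f) -(estart_rev f); apply: monotone_path1; first exact: symH.
  by rewrite reverseE erevK.
- by exists [::]; [exact: monotone_path_nil | move=> e []].
- exists (s ++ t); last exact: ends_in_cat.
  by apply: monotone_path_cat s1 t1 _; left.
Qed.

(** The segments of [belows_ascent] traversed backwards; they start in [reverse S]. *)
Lemma belows_descent y v : belows y v ->
  exists2 s, monotone_path H (reverse S) v s y & starts_in (reverse S) s.
Proof.
have tr s : S s -> reverse S (erev s) by move=> Ss; apply/reverseE; rewrite erevK.
elim=> {y v} [y v [s [Ss sv yP]]|y|x y z _ [s s1 s2] _ [t t1 t2]].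
- have path_s : monotone_path H (reverse S) (eend s) [:: erev s] (estart s).
    rewrite -(eend_rev s) -(estart_rev s); apply: monotone_path1; first exact/symH/SH.
    by rewrite reverseK => /reverseE; exact: S_rev.
  rewrite -sv; case: yP => [->|[f [Hf nSf fs fy]]].
    by exists [:: erev s] => // e t [<- _]; exact: tr.
  exists [:: erev s; f]; last by move=> e t [<- _]; exact: tr.
  apply: (@monotone_path_cat _ _ _ _ [:: erev s]) path_s _ _; last first.
    by left=> e t; rewrite -[LHS]/(rcons [::] (erev s)) => /rcons_inj[_ <-]; exact: tr.
  by rewrite -fs -fy; apply: monotone_path1; rewrite ?reverseK.
- by exists [::]; [exact: monotone_path_nil | move=> e []].
- exists (t ++ s); last exact: starts_in_cat.
  by apply: monotone_path_cat t1 s1 _; right.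
Qed.

(** * Potentials solved along a scaffold *)

Section Potentials.
Variables (F : fieldType) (w : edge G -> F).
Hypothesis Ww : weights w.
Implicit Types (u g c : vertex G -> F).

Lemma sub_laplacian_scaffold u s : S s -> sub_laplacian H w u (estart s) =
  w s * (u (estart s) - u (eend s))
    + sub_laplacian (remove_edge H (erev s)) w u (estart s).
Proof.
move=> Ss; have := sub_laplacianD1 w u (symH (SH Ss)).
by rewrite eend_rev estart_rev (Ww s).2.
Qed.

(** Traces a nonzero value back to its cause: a nonzero value at a vertex where no edge of [S] ends,
    or a nonzero Laplacian at the start of an edge of [S]. *)
Lemma nonzero_source u v : u v != 0 -> exists x, belows x v /\
  ((forall s, S s -> eend s <> x) /\ u x != 0 \/
   exists s, [/\ S s, eend s = x & sub_laplacian H w u (estart s) != 0]).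
Proof.
elim/(well_founded_ind below_wf): v => v IH uv; apply: contrapT => nex.
have [[s [Ss sv]]|noS] := pselect (exists s, S s /\ eend s = v); last first.
  apply: nex; exists v; split; first exact: rt_refl.
  by left; split=> // s Ss sv; apply: noS; exists s.
have u0 y : below y v -> u y = 0.
  move=> yv; apply/eqP; apply: contrapT => /negP /(IH _ yv)[x [xy xP]].
  by apply: nex; exists x; split=> //; apply: rt_trans xy _; exact: rt_step.
have us : u (estart s) = 0 by apply: u0; exists s; split=> //; left.
apply: nex; exists v; split; first exact: rt_refl.
(* All values below [v] vanish, so the Laplacian at [estart s] reduces to [- w s * u v]. *)
right; exists s; split=> //; rewrite sub_laplacian_scaffold // sub_laplacian_eq0 //.
  by rewrite us sv sub0r addr0 mulrN oppr_eq0 mulf_neq0 // (Ww s).1.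
move=> f fs [Hf nfs]; apply: u0; rewrite -sv; exact: below_neighbor.
Qed.

(** [g] prescribes the free values and [c] the Laplacians at the starts of edges of [S]; the
    equation at [estart s] is solved for the value at [eend s]. *)
Lemma potential_exists g c : exists u,
  (forall v, (forall s, S s -> eend s <> v) -> u v = g v) /\
  (forall s, S s -> sub_laplacian H w u (estart s) = c (estart s)).
Proof.
pose B v u := if pselect (exists s, S s /\ eend s = v) is left ex then
  let s := projT1 (cid ex) in u (estart s)
    + (sub_laplacian (remove_edge H (erev s)) w u (estart s) - c (estart s)) / w s
  else g v.
have [u uE] := wf_recursion 0 B below_wf; exists u; split=> [v noS|s Ss].
  by rewrite uE /B; case: pselect => // -[s [Ss sv]]; case: (noS s).
have us : u (eend s) = u (estart s)
    + (sub_laplacian (remove_edge H (erev s)) w u (estart s) - c (estart s)) / w s.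
  rewrite uE /B; case: pselect => [ex|[]]; last by exists s.
  case: cid => /= t [St ts]; rewrite (eend_inj St Ss ts) asboolT; last first.
    by exists s; split=> //; left.
  (* Every value read here is at a vertex below [eend s], so the mask of [wf_recursion] has no
     effect. *)
  congr (_ + (_ - _) / _); apply: eq_sub_laplacian => //.
    by rewrite asboolT //; exists s; split=> //; left.
  move=> f fs [Hf nf]; split=> //; rewrite asboolT //; exact: below_neighbor.
rewrite sub_laplacian_scaffold // us; have [ws _] := Ww s.
by field.
Qed.

(* [x] is the only vertex where the potential [u] is fed, so that it propagates
   along increasing paths from [x]; [u] is harmonic as soon as none of these
   ends at an interior vertex where no equation was solved. *)
Lemma potential_harmonic u x :
    (forall v, u v != 0 -> belows x v) ->
    (forall s, S s -> sub_interior H (estart s) ->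
      sub_laplacian H w u (estart s) = 0) ->
    (forall q (t : seq (edge G)), sub_interior H q -> ~ (@estart G @` S) q ->
      ~ monotone_path H S x t q) ->
  sub_harmonic H w u.
Proof.
move=> supp lap0 nopath q iq; have [[s Ss sq]|nSq] := pselect ((@estart G @` S) q).
  by rewrite -sq lap0 // sq.
apply: sub_laplacian_eq0 => [|f fq Hf]; apply/eqP; apply: contrapT => /negP /supp.
  by case/belows_ascent => s path_s _; exact: nopath path_s.
case/belows_ascent => s path_s ends_s.
(* The path to a neighbor of [q] is prolonged by [f], which is not in [reverse S] because no edge of
   [S] starts at [q]. *)
apply: (nopath q (s ++ [:: f])) => //; apply: monotone_path_cat path_s _ _; last by left.
rewrite -fq; apply: monotone_path1 => // /reverseE Sf.
by apply: nSq; exists (erev f); rewrite ?estart_rev.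
Qed.

End Potentials.

(* The same boundary data make a harmonic function vanish at [v] for all weights,
   provided that the values on which [v] depends are boundary data. *)
Lemma potential_vanish (F : fieldType) (w : edge G -> F) (u : vertex G -> F) v :
    edge_incident H -> weights w -> sub_harmonic H w u -> sub_vertex H v ->
    (forall x, belows x v -> sub_interior H x -> (@eend G @` S) x) ->
    (forall x, belows x v -> sub_boundary H x ->
      (forall s, S s -> eend s <> x) -> u x = 0) ->
    (forall s, S s -> belows (eend s) v -> sub_boundary H (estart s) ->
      sub_laplacian H w u (estart s) = 0) ->
  u v = 0.
Proof.
move=> incH Ww harm_u Hv int0 bd0 lap0; apply/eqP; apply: contrapT => /negP.
case/(nonzero_source Ww) => x [xv [[nSx ux]|[s [Ss sx lap_s]]]].
  have [ix|nix] := pselect (sub_interior H x).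
    by have [s Ss /(nSx s Ss)] := int0 x xv ix.
  by move: ux; rewrite bd0 ?eqxx //; split=> //; exact: belows_vertex xv Hv.
move: lap_s; have [is_|nis] := pselect (sub_interior H (estart s)).
  by rewrite harm_u ?eqxx.
rewrite lap0 ?eqxx // ?sx //; split=> //.
by rewrite -eend_rev; apply/incH/symH/SH.
Qed.

End Scaffold.

(** * Weights of the stripped edges and induction along the filtration *)

Section Recovery.
Variables (F : fieldType) (G : dgraph).
Implicit Types (H K : subdgraph G) (S : set (edge G)) (w : edge G -> F).

Lemma scaffold_mem H S : scaffold H S -> S `<=` sub_edge H.
Proof. by case=> -[]. Qed.

Lemma middle_not_end H S e q t : scaffold_middle H S (inr e) ->
  sub_vertex H (estart e) -> sub_interior H q ->
  monotone_path H (reverse S) (estart e) (e :: t) q -> (@eend G @` S) q.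
Proof.
move=> [_ nBE] Hs iq [Hp path_p inc_p]; apply: contrapT => nSq; apply: nBE; right.
by exists q; split=> //; exists t.
Qed.

Lemma middle_not_beginning H S e q t : scaffold_middle H S (inr e) ->
  sub_vertex H (estart e) -> sub_interior H q ->
  monotone_path H S (estart e) (e :: t) q -> (@estart G @` S) q.
Proof.
move=> [_ nBE] Hs iq [Hp path_p inc_p]; apply: contrapT => nSq; apply: nBE; left.
by exists q; split=> //; exists t.
Qed.

(* A unit potential at the boundary end of the spike propagates to a harmonic
   function whose boundary data force it to vanish at the other end. *)
Lemma spike_weight H S e w w' : edge_sym H -> edge_incident H ->
    weights w -> weights w' -> behavior_incl H w w' ->
    boundary_spike H e -> scaffold H S -> ~ (S `|` reverse S) e ->
    scaffold_middle H S (inr e) ->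
  w e = w' e.
Proof.
move=> symH incH Ww Ww' incl spe scS nSe mid_e.
have [He be _ ie] := spe; have [Hp nip] := be.
set p := estart e in be Hp nip *; set q := eend e in ie *.
have nSp s : S s -> estart s <> p.
  by move=> Ss /(spike_unique symH spe (scaffold_mem scS Ss)) se; apply: nSe; left; rewrite -se.
have npS s : S s -> eend s <> p.
  move=> Ss sp; apply: nSe; right; apply/reverseE.
  rewrite -(spike_unique symH spe (symH _ (scaffold_mem scS Ss))) ?erevK //.
  by rewrite estart_rev.
have neq_pq : p <> q by move=> pq; apply: nip; rewrite pq.
(* The only edge at [p] is the spike, outside [S] in both orientations. A dependence of [q] on [p]
   would thus begin with an edge of [S] starting at [q], which makes [q] depend on itself. *)
have not_pq : ~ belows H S p q.
  move=> pq; case: (clos_rt_head pq) => [//|[v [s [Ss sv pP]] vq]].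
  apply: acyclic (below_wf symH scS) vq _.
  exists s; split=> //; case: pP => [ps|[f [Hf nSf fs fp]]]; first by case: (nSp s Ss).
  left; rewrite -fs -(eend_rev f) /q; congr eend; apply/esym.
  by apply: (spike_unique symH spe); [exact: symH|rewrite estart_rev].
have [u [u_init u_lap]] :=
  potential_exists symH scS Ww (fun v => (v == p)%:R) (fun=> 0).
have up : u p = 1 by rewrite u_init ?eqxx.
have supp v : u v != 0 -> belows H S p v.
  case/(nonzero_source symH scS Ww) => x [xv [[nSx ux]|[s [Ss sx]]]].
    by move: ux; rewrite u_init //; case: (eqVneq x p) => [<-|]; rewrite ?eqxx.
  by rewrite u_lap ?eqxx.
have harm_u : sub_harmonic H w u.
  apply: (potential_harmonic symH scS supp) => [s Ss _|x t ix nSx path_t].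
    exact: u_lap.
  case: t path_t => [[_ /= px _]|f t path_t]; first by apply: nip; rewrite px.
  have fe : f = e.
    case: path_t => Hf [fp _] _; apply: (spike_unique symH spe) => //.
    by apply: Hf; rewrite mem_head.
  by rewrite fe in path_t; apply: nSx; exact: middle_not_beginning path_t.
have Hq : sub_vertex H q by exact: incH.
have vanish w0 u0 : weights w0 -> sub_harmonic H w0 u0 ->
    (forall x, sub_boundary H x ->
      u0 x = u x /\ sub_laplacian H w0 u0 x = sub_laplacian H w u x) ->
  u0 q = 0.
  move=> Ww0 harm_u0 bu0; apply: (potential_vanish symH scS incH Ww0) => //.
  - move=> x /(belows_descent symH scS)[t path_t starts_t] ix.
    apply: (@middle_not_end H S e x t) => //.
    (* Prefixing the spike gives a decreasing path from [e] itself, to which the Middle condition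
       applies. *)
    apply: (@monotone_path_cat _ _ _ _ [:: e]) _ path_t _; last by right.
    by apply: monotone_path1; rewrite // reverseK => Se; apply: nSe; left.
  - move=> x xq bx nSx; have [-> _] := bu0 x bx; rewrite u_init //.
    by case: (eqVneq x p) xq => // -> /not_pq.
  - by move=> s Ss _ bs; have [_ ->] := bu0 _ bs; exact: u_lap.
have [u' harm_u' bu'] := incl u harm_u.
(* With value 1 at [p] and 0 at [q], the current at [p] is the weight itself. *)
have := (bu' p be).2; rewrite !(sub_laplacian_spike _ _ symH spe) -/p -/q.
rewrite (vanish w' u') // (vanish w u) // (bu' p be).1 up.
by rewrite subr0 !mulr1 (Ww e).2 (Ww' e).2.
Qed.

(* A unit current fed at the start of the edge propagates to a harmonic function
   whose boundary data force all of that current to flow through the edge. *)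
Lemma boundary_edge_weight H S e w w' : edge_sym H -> edge_incident H ->
    weights w -> weights w' -> behavior_incl H w w' ->
    boundary_edge H e -> scaffold H S -> S e -> edge_in_middle H S e ->
  w e = w' e.
Proof.
move=> symH incH Ww Ww' incl [He ba bb] scS Se [mid_e mid_re].
have [SS0 [inj_end inj_start] _ _] := scS.
set a := estart e in ba *; set b := eend e in bb *.
have S_rev f : S f -> ~ reverse S f.
  by move=> Sf Rf; have : (S `&` reverse S) f by []; rewrite SS0.2.
have start_a s : S s -> estart s = a -> s = e.
  by move=> Ss sa; apply: inj_start => //; exact/mem_set.
have end_b s : S s -> eend s = b -> s = e.
  by move=> Ss sb; apply: inj_end => //; exact/mem_set.
have [u [u_init u_lap]] :=
  potential_exists symH scS Ww (fun=> 0) (fun v => (v == a)%:R).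
have supp v : u v != 0 -> belows H S b v.
  case/(nonzero_source symH scS Ww) => x [xv [[nSx]|[s [Ss sx]]]].
    by rewrite u_init ?eqxx.
  rewrite u_lap //; case: (eqVneq _ a) => [/(start_a _ Ss) se _|]; last by rewrite eqxx.
  by rewrite /b -se sx.
have harm_u : sub_harmonic H w u.
  apply: (potential_harmonic symH scS supp) => [s Ss is_|x t ix nSx path_t].
    rewrite u_lap //; case: (eqVneq _ a) => // sa; case: ba => _ [].
    by rewrite -sa.
  apply: nSx; apply: (@middle_not_beginning H S e x t) => //; first by case: ba.
  apply: (@monotone_path_cat _ _ _ _ [:: e]) _ path_t _.
    by apply: monotone_path1; last exact: S_rev.
  by left=> f r; rewrite -[LHS]/(rcons [::] e) => /rcons_inj[_ <-].
have vanish w0 u0 v : weights w0 -> sub_harmonic H w0 u0 ->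
    (forall x, sub_boundary H x ->
      u0 x = u x /\ sub_laplacian H w0 u0 x = sub_laplacian H w u x) ->
  below H S v b -> u0 v = 0.
  move=> Ww0 harm_u0 bu0 vb.
  have xb x : belows H S x v -> belows H S x b.
    by move=> xv; apply: rt_trans xv _; exact: rt_step.
  have Hb : sub_vertex H b by case: bb.
  apply: (potential_vanish symH scS incH Ww0) => //.
  - by apply: (belows_vertex symH scS incH _ Hb); exact: rt_step.
  - move=> x /xb/(belows_descent symH scS)[[|f t] path_t starts_t] ix.
      by case: path_t => _ /= bx _; case: bb => _ []; rewrite bx.
    have /reverseE Sf := starts_t f t erefl.
    (* A nonempty descent from [b] must begin with [erev e], so it is the reverse orientation of the
       edge that has to avoid the End. *)
    have fe : f = erev e.
      case: path_t => _ [fb _] _; rewrite -(end_b _ Sf) ?erevK //.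
      by rewrite eend_rev.
    rewrite fe in path_t; apply: (@middle_not_end H S (erev e) x t) => //.
      by rewrite estart_rev.
    by rewrite estart_rev.
  - by move=> x xv bx nSx; have [-> _] := bu0 x bx; rewrite u_init.
  - move=> s Ss sv bs; have [_ ->] := bu0 _ bs; rewrite u_lap //.
    case: (eqVneq _ a) => // /(start_a _ Ss) se.
    (* The unit current at [a] could reach [v] only through [b], but [v] lies below [b]. *)
    by rewrite se in sv; case: (acyclic (below_wf symH scS) sv vb).
have lap_a w0 u0 : weights w0 -> sub_harmonic H w0 u0 ->
    (forall x, sub_boundary H x ->
      u0 x = u x /\ sub_laplacian H w0 u0 x = sub_laplacian H w u x) ->
  (* As [b] is a boundary vertex, the value of [u] there serves for both weights; it is nonzero by
     this very equation. *)
  - (w0 e * u b) = 1.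
  move=> Ww0 harm_u0 bu0.
  have <- : sub_laplacian H w u a = 1 by rewrite u_lap ?eqxx.
  have [_ <-] := bu0 a ba; rewrite (sub_laplacian_scaffold symH scS Ww0) // -/a -/b.
  have u0a : u0 a = 0 by apply: (vanish w0) => //; exists e; split=> //; left.
  rewrite sub_laplacian_eq0 // => [|f fa [Hf nf]]; last first.
    by apply: (vanish w0) => //; exact: (below_neighbor symH scS).
  by rewrite u0a sub0r addr0 mulrN (bu0 b bb).1.
have [u' harm_u' bu'] := incl u harm_u.
have wb := lap_a w u Ww harm_u (fun _ _ => conj erefl erefl).
have := lap_a w' u' Ww' harm_u' bu'; rewrite -[RHS]wb => /oppr_inj/mulIf -> //.
by apply: contra_eqN wb => /eqP ->; rewrite mulr0 oppr0 eq_sym oner_eq0.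
Qed.

Definition stripped_edges_recoverable H K := forall e,
  sub_edge H e -> ~ sub_edge K e ->
  (boundary_edge H e -> exists S, [/\ scaffold H S, (S `|` reverse S) e
                                    & edge_in_middle H S e]) /\
  (boundary_spike H e -> exists S, [/\ scaffold H S, ~ (S `|` reverse S) e
                                     & edge_in_middle H S e]).

Lemma stripped_weight H K w w' e : edge_sym H -> edge_incident H ->
    weights w -> weights w' -> behavior_incl H w w' ->
    layer_stripping H K -> stripped_edges_recoverable H K ->
  sub_edge H e -> ~ sub_edge K e -> w e = w' e.
Proof.
move=> symH incH Ww Ww' incl [A bA|A _|A spA _] rec He nKe; last 1 first.
- have spike_eq a : A a -> w a = w' a.
    move=> Aa; have spa := spA _ Aa; have [Ha _ _ _] := spa.
    have nKa : ~ sub_edge (contract_spikes H A) a by case=> _ []; left.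
    have [_ /(_ spa)[S [scS nSa [mid_a _]]]] := rec a Ha nKa.
    exact: spike_weight scS nSa mid_a.
  have [Ae|[a Aa <-]] : (A `|` reverse A) e.
  + by apply: contrapT => nA; apply: nKe; split.
  + exact: spike_eq.
  + by rewrite (Ww a).2 (Ww' a).2; exact: spike_eq.
- have be : boundary_edge H e.
    have [/bA//|[a /bA[Ha bs bt] <-]] : (A `|` reverse A) e.
      by apply: contrapT => nA; apply: nKe; split.
    by split; rewrite ?estart_rev ?eend_rev //; exact: symH.
  have [/(_ be)[S [scS [Se|/reverseE Se] mid_e]] _] := rec e He nKe.
    exact: boundary_edge_weight scS Se mid_e.
  (* Here the scaffold contains the opposite orientation, so the argument is applied to [erev e]. *)
  rewrite -(Ww e).2 -(Ww' e).2; apply: boundary_edge_weight scS Se _ => //.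
    by case: be => _ bs bt; split; rewrite ?estart_rev ?eend_rev //; exact: symH.
  by case: mid_e => m1 m2; split; rewrite ?erevK.
- by case: nKe.
Qed.

Lemma behavior_incl_strip H K w w' : edge_sym H -> weights w -> weights w' ->
    layer_stripping H K ->
    (forall e, sub_edge H e -> ~ sub_edge K e -> w e = w' e) ->
  behavior_incl H w w' -> behavior_incl K w w'.
Proof.
move=> symH Ww Ww' [A bA|A _|A spA trivA] eqw.
- exact: behavior_incl_delete_edges.
- exact: behavior_incl_delete_vertices.
- exact: behavior_incl_contract_spikes.
Qed.

End Recovery.

Theorem mainTheorem1 (G : dgraph) (hG : recoverable_by_scaffolds G)
  (F : fieldType) : recoverable F G.
Proof.
case: hG => N [Gs [[G0 strip _ noedge] rec]] w w' /set_mem Ww /set_mem Ww' eqL.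
(* The induction carries the agreement of the weights on all edges removed so far; each edge is
   eventually removed since the edge sets have empty intersection. *)
have step j : indices N j -> [/\ edge_sym (Gs j), edge_incident (Gs j),
    behavior_incl (Gs j) w w' & forall e, ~ sub_edge (Gs j) e -> w e = w' e].
  elim: j => [_|j IH Nj1].
    by rewrite G0; split=> // [|e []//]; exact: behavior_incl_whole.
  have [|symj incj inclj eqj] := IH; first by case: N Nj1 {strip noedge rec IH} => //= n /ltnW.
  have stripj := strip j Nj1.
  have eq_strip e : sub_edge (Gs j) e -> ~ sub_edge (Gs j.+1) e -> w e = w' e.
    by apply: stripped_weight => // f; exact: rec.
  split; first exact: edge_sym_strip stripj symj.
  - exact: edge_incident_strip stripj symj incj.
  - exact: behavior_incl_strip stripj eq_strip inclj.
  - by move=> e nKe; have [He|/eqj//] := pselect (sub_edge (Gs j) e); exact: eq_strip.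
apply/funext => e.
have : ~ (\bigcap_(j in indices N) sub_edge (Gs j)) e by rewrite noedge.
by case/existsNP => j /not_implyP[/step[_ _ _ eqj]]; exact: eqj.
Qed.
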